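(* Let $B(t,x;132,213)=\sum_{n=0}^{\infty}\sum_{\pi\in\mathfrak{S}_n(132,213)}t^{\mathrm{bdes}(\pi)}x^n$. Then $$B(t,x;132,213)=\frac{1-x+(1-t)x^{2}-(1-t)^{2}x^{3}}{1-2x+(1-t)x^{2}+t(1-t)x^{3}}.$$
   Context: $\mathfrak{S}_n$ is the set of permutations $\pi=\pi_1\pi_2\cdots\pi_n$ of $[n]=\{1,\dots,n\}$ in one-line notation ($\mathfrak{S}_0$ consists of the empty permutation). $\mathfrak{S}_n(132,213)$ is the set of $\pi\in\mathfrak{S}_n$ having no length-three subsequence with the same relative order as $132$ or as $213$. An index $k\in[n-1]$ is a big descent of $\pi\in\mathfrak{S}_n$ if $\pi_k>\pi_{k+1}+1$; $\mathrm{bdes}(\pi)$ is the number of big descents of $\pi$. The identity is one of formal power series in $x$ with coefficients polynomials in $t$. *)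

(* Defs.v *)
From mathcomp Require Import all_boot all_order all_algebra all_fingroup.

Set Implicit Arguments.
Unset Strict Implicit.
Unset Printing Implicit Defensive.

Import GRing.Theory.
Local Open Scope ring_scope.

(* Permutations of [n] are elements of 'S_n, so positions and values are numbered
   from 0 instead of 1; neither pattern containment nor big descents depend on
   this shift. A pattern is given by its one-line notation. *)

Definition contains_pattern (p : seq nat) (n : nat) (s : 'S_n) : bool :=
  [exists f : {ffun 'I_(size p) -> 'I_n},
    [forall a : 'I_(size p), forall b : 'I_(size p),
      ((a < b)%N ==> (f a < f b)%N) &&
      ((nth 0%N p a < nth 0%N p b)%N == (s (f a) < s (f b))%N)]].

Definition avoids_pattern (p : seq nat) (n : nat) (s : 'S_n) : bool :=
  ~~ contains_pattern p s.

Definition Av_132_213 (n : nat) : {set 'S_n} :=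
  [set s | avoids_pattern [:: 1; 3; 2]%N s && avoids_pattern [:: 2; 1; 3]%N s].

Definition bdes (n : nat) (s : 'S_n) : nat :=
  #|[set k : 'I_n | [exists j : 'I_n, (j == k.+1 :> nat) && ((s j).+1 < s k)%N]]|.

(* Formal power series, as coefficient sequences; they are compared with =1. *)
Definition fps (R : Type) : Type := nat -> R.

Definition fps_of_poly (R : nzRingType) (p : {poly R}) : fps R := fun n => p`_n.

Definition fps_mul (R : nzRingType) (f g : fps R) : fps R :=
  fun n => \sum_(i < n.+1) f i * g (n - i)%N.

(* The first n coefficients of the inverse of f, from the recursion
   g_0 = f_0^-1 and g_n = - f_0^-1 * (f_n g_0 + ... + f_1 g_(n-1)). *)
Fixpoint fps_inv_prefix (R : unitRingType) (f : fps R) (n : nat) : seq R :=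
  if n is m.+1 then
    let s := fps_inv_prefix f m in
    rcons s (if m is 0 then (f 0%N)^-1
             else - (f 0%N)^-1 * \sum_(i < m) f (m - i)%N * s`_i)
  else [::].

(* Meaningful when f_0 is a unit, see fps_mulV. *)
Definition fps_inv (R : unitRingType) (f : fps R) : fps R :=
  fun n => (fps_inv_prefix f n.+1)`_n.

Definition fps_div (R : unitRingType) (f g : fps R) : fps R :=
  fps_mul f (fps_inv g).

Lemma size_fps_inv_prefix (R : unitRingType) (f : fps R) n :
  size (fps_inv_prefix f n) = n.
Proof. by elim: n => //= n IHn; rewrite size_rcons IHn. Qed.

Lemma nth_fps_inv_prefix (R : unitRingType) (f : fps R) n i :
  (i < n)%N -> (fps_inv_prefix f n)`_i = fps_inv f i.
Proof.
elim: n => // n IHn; rewrite ltnS leq_eqVlt => /orP[/eqP-> // | lt_in].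
by rewrite -IHn //= nth_rcons size_fps_inv_prefix lt_in.
Qed.

Lemma fps_inv0 (R : unitRingType) (f : fps R) : fps_inv f 0%N = (f 0%N)^-1.
Proof. by []. Qed.

Lemma fps_invS (R : unitRingType) (f : fps R) n :
  fps_inv f n.+1 =
    - (f 0%N)^-1 * \sum_(i < n.+1) f (n.+1 - i)%N * fps_inv f i.
Proof.
rewrite {1}/fps_inv; set m := n.+1.
have -> : fps_inv_prefix f m.+1 = rcons (fps_inv_prefix f m)
    (- (f 0%N)^-1 * \sum_(i < m) f (m - i)%N * (fps_inv_prefix f m)`_i) by [].
rewrite nth_rcons size_fps_inv_prefix ltnn eqxx; congr (_ * _).
by apply: eq_bigr => i _; rewrite nth_fps_inv_prefix.
Qed.

Lemma fps_mulV (R : unitRingType) (f : fps R) :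
  f 0%N \is a GRing.unit -> fps_mul f (fps_inv f) =1 fps_of_poly 1.
Proof.
move=> uf0 n; rewrite /fps_of_poly coef1 /fps_mul (reindex_inj rev_ord_inj) /=.
rewrite (eq_bigr (fun i : 'I_n.+1 => f (n - i)%N * fps_inv f i)); last first.
  by move=> i _; rewrite subSS subKn // -ltnS.
rewrite big_ord_recr /= subnn.
case: n => [|n]; first by rewrite big_ord0 add0r fps_inv0 mulrV.
by rewrite fps_invS mulrA mulrN mulrV // mulN1r addrN.
Qed.

(* B(t, x; 132, 213), as a series in x over the polynomials in t. *)
Definition B_132_213 : fps {poly int} :=
  fun n => \sum_(s in Av_132_213 n) 'X^(bdes s).

(* Main.v *)
(* A permutation s avoids 132 and 213 iff, for i < j < k, s i < s k forces
   s i < s j < s k. Hence an ascent of s is a step of exactly +1, and a descent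
   is big iff it is adjacent to an ascent, so bdes s depends only on the
   ascent/descent word of s. An avoider of size n + 1 arises uniquely from one of
   size n >= 1 by prepending either the maximum or a copy of the first entry
   placed just below it; this adds one arbitrary letter in front of the word.
   Summing t ^ bdes over all words by their first letter, with the preceding
   letter as state, gives a linear system of order three, whose characteristic
   polynomial is the denominator of the series. *)

Require Import Defs.
From mathcomp Require Import all_boot all_order all_algebra all_fingroup.
From mathcomp Require Import zify ring.

Set Implicit Arguments.
Unset Strict Implicit.
Unset Printing Implicit Defensive.

Import GRing.Theory.

(** * Pattern avoidance as a condition on triples of positions *)

(** Three comparisons suffice: the reversed ones follow because the entries of the pattern and of
    [s] are distinct. *)
Lemma contains_pattern3P (a b c n : nat) (s : 'S_n) :
  uniq [:: a; b; c] ->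
  reflect (exists i j k : 'I_n,
             [/\ i < j, j < k, (a < b) = (s i < s j), (a < c) = (s i < s k)
               & (b < c) = (s j < s k)])
          (contains_pattern [:: a; b; c] s).
Proof.
rewrite /= !inE negb_or andbT => /andP[/andP[ab ac] bc].
have neq_s (i j : 'I_n) : i < j -> s i <> s j :> nat.
  by move=> lt_ij /val_inj/perm_inj eq_ij; rewrite eq_ij ltnn in lt_ij.
apply: (iffP existsP) => [[f /forallP fP] | [i [j [k [ij jk abE acE bcE]]]]].
  pose o (m : nat) : 'I_3 := inord m.
  have vo m : m < 3 -> nat_of_ord (o m) = m by move=> ?; rewrite inordK.
  have fE x y : x < 3 -> y < 3 -> (x < y -> f (o x) < f (o y)) /\
     (nth 0 [:: a; b; c] x < nth 0 [:: a; b; c] y) = (s (f (o x)) < s (f (o y))).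
    move=> x3 y3; have := forallP (fP (o x)) (o y).
    by rewrite !vo // => /andP[/implyP ? /eqP].
  exists (f (o 0)), (f (o 1)), (f (o 2)).
  have [/(_ isT) h01 e01] := fE 0 1 isT isT.
  have [_ e02] := fE 0 2 isT isT.
  have [/(_ isT) h12 e12] := fE 1 2 isT isT.
  by split.
have := neq_s i j ij; have := neq_s j k jk; have := neq_s i k (ltn_trans ij jk).
move=> sik sjk sij.
exists [ffun x : 'I_3 => nth i [:: i; j; k] x].
apply/forallP=> x; apply/forallP=> y; rewrite !ffunE.
by move: x y => [[|[|[|x]]] ?] [[|[|[|y]]] ?] //=; rewrite ?ltnn; lia.
Qed.

(** When [s i < s k], a middle value above [s k] gives 132 and one below [s i] gives 213. *)
Lemma Av_132_213P (n : nat) (s : 'S_n) :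
  reflect (forall i j k : 'I_n, i < j -> j < k -> s i < s k -> s i < s j < s k)
          (s \in Av_132_213 n).
Proof.
rewrite inE /avoids_pattern; apply: (iffP andP) => [[/negP no132 /negP no213]|avs].
  move=> i j k ij jk sik.
  have sij : s i <> s j :> nat.
    by move=> /val_inj/perm_inj eq_ij; rewrite eq_ij ltnn in ij.
  have sjk : s j <> s k :> nat.
    by move=> /val_inj/perm_inj eq_jk; rewrite eq_jk ltnn in jk.
  case: (ltnP (s i) (s j)) => [ltij|leji] /=.
    case: ltnP => // lekj; case: no132; apply/contains_pattern3P => //.
    by exists i, j, k; split=> //; lia.
  by case: no213; apply/contains_pattern3P => //; exists i, j, k; split=> //; lia.
by split; apply/contains_pattern3P => // -[i [j [k [ij jk e1 e2 e3]]]];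
  have := avs i j k ij jk; lia.
Qed.

(* [inord] sends positions i > n to 0, so values there are junk. *)
Definition oneline (n : nat) (s : 'S_n.+1) (i : nat) : nat := s (inord i).

Definition ascents (n : nat) (s : 'S_n.+1) : seq bool :=
  mkseq (fun i => oneline s i < oneline s i.+1) n.

Lemma oneline_ord (n : nat) (s : 'S_n.+1) (i : 'I_n.+1) : oneline s i = s i.
Proof. by rewrite /oneline inord_val. Qed.

Lemma oneline_leq (n : nat) (s : 'S_n.+1) (i : nat) : oneline s i <= n.
Proof. by rewrite -ltnS ltn_ord. Qed.

Lemma oneline_inj (n : nat) (s : 'S_n.+1) (i j : nat) :
  i <= n -> j <= n -> oneline s i = oneline s j -> i = j.
Proof.
by move=> le_in le_jn /val_inj/perm_inj/(congr1 val) /=; rewrite !inordK.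
Qed.

Lemma oneline_surj (n : nat) (s : 'S_n.+1) (v : nat) :
  v <= n -> exists2 i, i <= n & oneline s i = v.
Proof.
move=> le_vn; exists ((s^-1)%g (inord v)); first by rewrite -ltnS.
by rewrite oneline_ord permKV inordK.
Qed.

Lemma oneline_neq (n : nat) (s : 'S_n.+1) (i j : nat) :
  i < j <= n -> oneline s i <> oneline s j.
Proof. by move=> /andP[ij jn] /oneline_inj; lia. Qed.

Lemma Av_onelineP (n : nat) (s : 'S_n.+1) :
  reflect (forall i j k, i < j -> j < k -> k <= n ->
             oneline s i < oneline s k ->
             oneline s i < oneline s j < oneline s k)
          (s \in Av_132_213 n.+1).
Proof.
apply: (iffP (Av_132_213P s)) => avs i j k.
  by move=> ij jk kn; apply: avs; rewrite !inordK //; lia.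
by move=> ij jk; rewrite -!oneline_ord; apply: avs => //; rewrite -ltnS.
Qed.

(** * Ascents and big descents of an avoider *)

Section Avoider.

Variables (n : nat) (s : 'S_n.+1).
Hypothesis avs : s \in Av_132_213 n.+1.
Local Notation f := (oneline s).

(** A skipped value [(f k).+1] would form, with positions [k] and [k.+1], a 213 if it occurs before
    them and a 132 if after. *)
Lemma ascent_step (k : nat) : k < n -> f k < f k.+1 -> f k.+1 = (f k).+1.
Proof.
move=> kn asc; have [//|neq] := eqVneq (f k.+1) (f k).+1.
have [i le_in fi] : exists2 i, i <= n & f i = (f k).+1.
  by apply: oneline_surj; have := oneline_leq s k.+1; lia.
have [ik|] := ltnP i k.
  by have := Av_onelineP s avs i k k.+1 ik (ltnSn k) kn; lia.
rewrite leq_eqVlt => /orP[/eqP ki|]; first by rewrite -ki in fi; lia.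
rewrite leq_eqVlt => /orP[/eqP ki|ki]; first by rewrite -ki in fi; lia.
by have := Av_onelineP s avs k k.+1 i (ltnSn k) ki le_in; lia.
Qed.

(** From right to left: an adjacent ascent rises by exactly 1, so a descent by 1 next to it would
    repeat a value. *)
Lemma big_descentE (k : nat) : k < n ->
  ((f k.+1).+1 < f k) =
  ~~ (f k < f k.+1) &&
  ((0 < k) && (f k.-1 < f k) || (k.+1 < n) && (f k.+1 < f k.+2)).
Proof.
move=> kn; have [asc|] := ltnP (f k) (f k.+1); first by lia.
rewrite leq_eqVlt => /orP[/eqP/esym/oneline_neq|des] /=; first by lia.
apply/idP/idP => [big|/orP[]/andP[]].
(* Without adjacent ascents, the values f k - 1 and f k.+1 + 1 must both occur
   after k.+1, and the latter has no admissible position. *)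
- apply/negPn/negP; rewrite negb_or => /andP[nasc1 nasc2].
  have [i le_in fi] : exists2 i, i <= n & f i = (f k).-1.
    by apply: oneline_surj; have := oneline_leq s k; lia.
  have [j le_jn fj] : exists2 j, j <= n & f j = (f k.+1).+1.
    by apply: oneline_surj; have := oneline_leq s k; lia.
  have ki : k < i.
    rewrite ltnNge leq_eqVlt; apply/negP => /orP[/eqP ik|ik].
      by rewrite ik in fi; lia.
    have [ik1|] := ltnP i k.-1.
      have := Av_onelineP s avs i k.-1 k ik1.
      have := @oneline_neq _ s k.-1 k; lia.
    move=> k1i; have ik1 : i = k.-1 by lia.
    by rewrite ik1 in fi; lia.
  have kj : k.+1 < j.
    have [jk|] := ltnP j k.
      (* In the triple [j < k < i], [f j < f i] is impossible since [f k] exceeds [f i]; and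
         [f j = f i] would force [j = i]. *)
      have := @oneline_neq _ s k i; have := Av_onelineP s avs j k i jk ki le_in.
      have [fij|] := ltnP (f j) (f i); first by lia.
      move=> fji; have fji' : f j = f i by lia.
      by have := oneline_inj le_jn le_in fji'; lia.
    rewrite leq_eqVlt => /orP[/eqP kj|]; first by rewrite -kj in fj; lia.
    rewrite leq_eqVlt => /orP[/eqP kj|//]; first by rewrite -kj in fj; lia.
  (* Position [k.+2] finds no value strictly between the consecutive [f k.+1] and [f j]; if
     [j = k.+2], it ends an excluded ascent. *)
  have [k2j|] := ltnP k.+2 j.
    by have := Av_onelineP s avs k.+1 k.+2 j; have := @oneline_neq _ s k.+1 k.+2; lia.
  by move=> jk; have jk2 : j = k.+2 by [lia]; rewrite jk2 in fj le_jn; lia.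
- case: k kn des => // k kn des _ asc.
  have := ascent_step (ltnW kn) asc; have := @oneline_neq _ s k k.+2; lia.
- by move=> k1n asc; have := ascent_step k1n asc; have := @oneline_neq _ s k k.+2; lia.
Qed.

End Avoider.

(* Letters are [true] for ascents; p is the letter preceding w. *)
Definition word_bdes (p : bool) (w : seq bool) : nat :=
  \sum_(k < size w) (~~ nth false w k && (nth false (p :: w) k || nth false w k.+1)).

Lemma word_bdes_cons (p b : bool) (w : seq bool) :
  word_bdes p (b :: w) = (~~ b && (p || head false w)) + word_bdes b w.
Proof. by rewrite /word_bdes /= big_ord_recl /= nth0. Qed.

Lemma bdes_ascents (n : nat) (s : 'S_n.+1) :
  s \in Av_132_213 n.+1 -> bdes s = word_bdes false (ascents s).
Proof.
move=> avs; rewrite /bdes /word_bdes size_mkseq -sum1_card big_mkcond /=.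
(* The last of the n + 1 positions starts no step. *)
rewrite big_ord_recr /= inE [X in _ + X](_ : _ = 0) ?addn0; last first.
  by case: existsP => // -[[j lt_j] /andP[/eqP /= jE]]; lia.
apply: eq_bigr => k _; rewrite inE.
transitivity (nat_of_bool ((oneline s k.+1).+1 < oneline s k)).
  have -> : oneline s k = s (widen_ord (leqnSn n) k).
    by rewrite -oneline_ord.
  case: existsP => [[j /andP[/eqP jk]]|no].
    by rewrite -jk /= oneline_ord => ->.
  case: ltnP => // big; case: no; exists (inord k.+1).
  by rewrite inordK ?eqxx //=; have := ltn_ord k; lia.
have kn := ltn_ord k.
rewrite big_descentE // nth_mkseq //; congr (nat_of_bool (_ && (_ || _))).
  by case: k kn => -[|k] //= ? kn; rewrite nth_mkseq // ltnW.
(* Past the end of the word, the default [false] of [nth] stands for the missing ascent. *)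
have [k1n|nk1] := ltnP k.+1 n; first by rewrite nth_mkseq.
by rewrite nth_default // size_mkseq.
Qed.

(** * Building avoiders by prepending an entry *)

(** [lift_perm] raises the values at or above the new one, so reusing the value [s ord0] places the
    new entry just below the old first one. *)
Definition prepend (n : nat) (s : 'S_n.+1) (b : bool) : 'S_n.+2 :=
  lift_perm ord0 (if b then widen_ord (leqnSn _) (s ord0) else ord_max) s.

Lemma oneline_lift_perm (n : nat) (v : 'I_n.+2) (s : 'S_n.+1) (i : nat) :
  oneline (lift_perm ord0 v s) i =
  if i is j.+1 then
    if j <= n then bump v (oneline s j) else oneline (lift_perm ord0 v s) i
  else v.
Proof.
case: i => [|i].
  by rewrite /oneline (_ : inord 0 = ord0) ?lift_perm_id //; apply/val_inj/inordK.
case: leqP => // le_in; rewrite /oneline.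
rewrite (_ : inord i.+1 = lift ord0 (inord i)) ?lift_perm_lift //.
by apply: val_inj; rewrite /= !inordK.
Qed.

Lemma oneline_prepend0 (n : nat) (s : 'S_n.+1) (b : bool) :
  oneline (prepend s b) 0 = if b then oneline s 0 else n.+1.
Proof. by rewrite oneline_lift_perm; case: b => //=; rewrite -oneline_ord. Qed.

Lemma oneline_prependS (n : nat) (s : 'S_n.+1) (b : bool) (i : nat) : i <= n ->
  oneline (prepend s b) i.+1 =
  (b && (oneline s 0 <= oneline s i)) + oneline s i.
Proof.
move=> le_in; rewrite oneline_lift_perm le_in /bump.
case: b => /=; first by rewrite -oneline_ord.
by have := oneline_leq s i; case: ltnP => //=; lia.
Qed.

(** Only triples starting at the new entry are new: nothing exceeds a maximum, and a copy just below
    the old first entry compares with later entries as that entry does. *)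
Lemma prepend_Av (n : nat) (s : 'S_n.+1) (b : bool) :
  s \in Av_132_213 n.+1 -> prepend s b \in Av_132_213 n.+2.
Proof.
move=> avs; apply/Av_onelineP => i [//|j] [//|k] ij jk kn.
rewrite !oneline_prependS; try lia.
case: i ij => [_|i ij].
  rewrite oneline_prepend0; case: b => /=; last by have := oneline_leq s k; lia.
  have := @oneline_neq _ s 0 k; case: j jk => [|j] jk; first by lia.
  by have := Av_onelineP _ avs 0 j.+1 k isT jk kn; lia.
rewrite oneline_prependS; last lia.
have := Av_onelineP _ avs i j k ij jk kn.
have := @oneline_neq _ s i k; case: b => /=; lia.
Qed.

Lemma ascents_prepend (n : nat) (s : 'S_n.+1) (b : bool) :
  ascents (prepend s b) = b :: ascents s.
Proof.
rewrite /ascents /mkseq /= (iotaDl 1 0) -map_comp; congr cons.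
  rewrite oneline_prepend0 oneline_prependS //; have := oneline_leq s 0.
  by case: b => /=; lia.
apply/eq_in_map => i; rewrite mem_iota => /= lt_in.
rewrite !oneline_prependS //; last lia.
by rewrite add1n; case: b => /=; lia.
Qed.

Lemma lift_perm_surj (n : nat) (u : 'S_n.+2) :
  exists s : 'S_n.+1, u = lift_perm ord0 (u ord0) s.
Proof.
have neq k : u ord0 != u (lift ord0 k) by rewrite (inj_eq perm_inj) neq_lift.
pose g k := sval (unlift_some (neq k)).
have gE k : lift (u ord0) (g k) = u (lift ord0 k).
  by rewrite /g; case: (unlift_some _).
have g_inj : injective g.
  by move=> k l /(congr1 (lift (u ord0))); rewrite !gE => /perm_inj/lift_inj.
exists (perm g_inj); apply/permP => i.
case: (unliftP ord0 i) => [k|] ->; last by rewrite lift_perm_id.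
by rewrite lift_perm_lift permE gE.
Qed.

Lemma prepend_surj (n : nat) (u : 'S_n.+2) : u \in Av_132_213 n.+2 ->
  exists2 s, s \in Av_132_213 n.+1 & exists b, u = prepend s b.
Proof.
move=> avu; have [s uE] := lift_perm_surj u.
have u0 : oneline u 0 = u ord0 by rewrite -oneline_ord.
have uS i : i <= n -> oneline u i.+1 = bump (u ord0) (oneline s i).
  by move=> le_in; rewrite uE oneline_lift_perm le_in lift_perm_id.
exists s.
  apply/Av_onelineP => i j k ij jk kn.
  have := Av_onelineP _ avu i.+1 j.+1 k.+1 ij jk kn.
  by rewrite !uS /bump; try lia.
have [asc|des] := ltnP (oneline u 0) (oneline u 1).
  exists true; rewrite uE; congr lift_perm; apply: ord_inj => /=.
  rewrite -(oneline_ord s) /=.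
  have := ascent_step avu (ltn0Sn _) asc; rewrite u0 uS // /bump; lia.
exists false; rewrite uE; congr lift_perm; apply: ord_inj => /=.
rewrite -u0.
(* After an initial descent, a maximum at position 2 or later would complete a 213, so it comes
   first. *)
have [[|[|i]] le_in ui] := oneline_surj u (leqnn n.+1) => //.
  by have := oneline_leq u 0; lia.
have := Av_onelineP _ avu 0 1 i.+2 isT isT le_in.
have := @oneline_neq _ u 0 i.+2; have := oneline_leq u 0; lia.
Qed.

Lemma prepend_inj (n : nat) :
  injective (fun sb : 'S_n.+1 * bool => prepend sb.1 sb.2).
Proof.
move=> [s b] [s' b'] /= eq_p.
have [eq_b _] : b :: ascents s = b' :: ascents s'.
  by rewrite -!ascents_prepend eq_p.
have /permP eq_at := eq_p; congr pair; last by [].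
apply/permP => k; have := eq_at (lift ord0 k); have := eq_at ord0.
by rewrite !lift_perm_id !lift_perm_lift => -> /lift_inj.
Qed.

Local Open Scope ring_scope.

Definition sum_Av (V : nmodType) (n : nat) (F : seq bool -> V) : V :=
  \sum_(s in Av_132_213 n.+1) F (ascents s).

Lemma sum_Av0 (V : nmodType) (F : seq bool -> V) : sum_Av 0 F = F [::].
Proof.
rewrite /sum_Av (big_pred1 1%g) // => s /=.
have -> : s = 1%g by apply/permP => i; rewrite !ord1.
by rewrite eqxx; apply/Av_132_213P => i j k; rewrite !ord1.
Qed.

(** [prepend] is a bijection from pairs of an avoider and a letter. *)
Lemma sum_AvS (V : nmodType) (n : nat) (F : seq bool -> V) :
  sum_Av n.+1 F =
    sum_Av n (fun w => F (true :: w)) + sum_Av n (fun w => F (false :: w)).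
Proof.
have AvE : Av_132_213 n.+2 =
    (fun sb => prepend sb.1 sb.2) @: setX (Av_132_213 n.+1) [set: bool].
  apply/setP => u; apply/idP/imsetP => [/prepend_surj[s avs [b ->]]|].
    by exists (s, b); rewrite // inE avs inE.
  by move=> [[s b]]; rewrite in_setX => /andP[avs _] ->; apply: prepend_Av.
rewrite /sum_Av AvE big_imset /=; last by move=> ? ? _ _; apply: prepend_inj.
rewrite -big_split /=.
transitivity (\sum_(s in Av_132_213 n.+1) \sum_(b in [set: bool])
                F (ascents (prepend s b))).
  by rewrite pair_big_dep; apply: eq_bigl => -[s b]; rewrite in_setX.
apply: eq_bigr => s _; rewrite (eq_bigl predT); last by move=> b; rewrite inE.
by rewrite big_bool /= !ascents_prepend.
Qed.

(** * Division of series through truncation *)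

(** This lets series borrow ring laws from polynomials that agree with them up to degree n. *)
Lemma fps_mul_coef (R : nzRingType) (f g : fps R) (p q : {poly R}) (n : nat) :
  (forall i, (i <= n)%N -> f i = p`_i) -> (forall i, (i <= n)%N -> g i = q`_i) ->
  fps_mul f g n = (p * q)`_n.
Proof.
move=> fp gq; rewrite coefM; apply: eq_bigr => i _.
by rewrite fp ?gq //; have := ltn_ord i; lia.
Qed.

Lemma fps_div_unique (R : comUnitRingType) (f g h : fps R) :
  f 0%N \is a GRing.unit -> fps_mul f g =1 h -> g =1 fps_div h f.
Proof.
move=> uf0 fgh n; pose T (u : fps R) := \poly_(i < n.+1) u i.
have TE (u : fps R) i : (i <= n)%N -> u i = (T u)`_i.
  by move=> le_in; rewrite coef_poly ltnS le_in.
have mulTE (u v : fps R) i : (i <= n)%N -> fps_mul u v i = (T u * T v)`_i.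
  by move=> le_in; apply: fps_mul_coef => j le_ji; apply: TE; lia.
have hE i : (i <= n)%N -> h i = (T f * T g)`_i by move=> ?; rewrite -fgh mulTE.
(* Up to degree n, [h * f^-1 = (f * g) * f^-1 = g * (f * f^-1)]. *)
rewrite /fps_div (fps_mul_coef hE (TE _)) mulrAC mulrC.
have oneE i : (i <= n)%N -> fps_of_poly 1 i = (T f * T (fps_inv f))`_i.
  by move=> le_in; rewrite -(fps_mulV uf0) mulTE.
rewrite -(fps_mul_coef (TE g) oneE) (@fps_mul_coef _ _ _ (T g) 1) ?mulr1 -?TE //.
exact: TE.
Qed.

Lemma sum_Av_eq (V : nmodType) (n : nat) (F G : seq bool -> V) :
  F =1 G -> sum_Av n F = sum_Av n G.
Proof. by move=> eqFG; apply: eq_bigr. Qed.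

Lemma sum_Av_mul (R : nzRingType) (n : nat) (c : R) (F : seq bool -> R) :
  sum_Av n (fun w => c * F w) = c * sum_Av n F.
Proof. by rewrite /sum_Av mulr_sumr. Qed.

(** * Recurrences by the first letter *)

Section Recurrence.

Variables (R : comNzRingType) (t : R).

Definition bdes_sum (p : bool) (n : nat) : R :=
  sum_Av n (fun w => t ^+ word_bdes p w).

(* The words are preceded by a descent that is itself preceded by a descent. *)
Definition bdes_sum_descent (n : nat) : R :=
  sum_Av n (fun w => t ^+ word_bdes false (false :: w)).

Lemma bdes_sum0 (p : bool) : bdes_sum p 0 = 1.
Proof. by rewrite /bdes_sum sum_Av0 /word_bdes big_ord0. Qed.

Lemma bdes_sum_descent0 : bdes_sum_descent 0 = 1.
Proof. by rewrite /bdes_sum_descent sum_Av0 word_bdes_cons /word_bdes big_ord0. Qed.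

Lemma bdes_sum_falseS (n : nat) :
  bdes_sum false n.+1 = bdes_sum true n + bdes_sum_descent n.
Proof.
rewrite /bdes_sum sum_AvS; congr (_ + _).
by apply: sum_Av_eq => w; rewrite word_bdes_cons.
Qed.

(** A descent right after an ascent is big whatever follows, hence the factor [t]. *)
Lemma bdes_sum_trueS (n : nat) :
  bdes_sum true n.+1 = bdes_sum true n + t * bdes_sum false n.
Proof.
rewrite /bdes_sum sum_AvS -sum_Av_mul; congr (_ + _); apply: sum_Av_eq => w.
  by rewrite word_bdes_cons.
by rewrite word_bdes_cons exprS.
Qed.

(** An ascent makes the pending descent big; a descent leaves it small and becomes the pending
    one. *)
Lemma bdes_sum_descentS (n : nat) :
  bdes_sum_descent n.+1 = t * bdes_sum true n + bdes_sum_descent n.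
Proof.
rewrite /bdes_sum_descent sum_AvS -sum_Av_mul.
by congr (_ + _); apply: sum_Av_eq => w; rewrite !word_bdes_cons ?exprS.
Qed.

(** Cayley-Hamilton for the three recurrences, checked by expressing everything in the three sums at
    [n]. *)
Lemma bdes_sum_rec (n : nat) :
  bdes_sum false n.+3 - 2%:R * bdes_sum false n.+2
    + (1 - t) * bdes_sum false n.+1 + t * (1 - t) * bdes_sum false n = 0.
Proof. rewrite !(bdes_sum_falseS, bdes_sum_trueS, bdes_sum_descentS); ring. Qed.

End Recurrence.

(** * The generating function *)

Lemma B_132_213_0 : B_132_213 0%N = 1.
Proof.
rewrite /B_132_213 (big_pred1 1%g) => [|s /=].
  rewrite /bdes (_ : [set _ | _] = set0) ?cards0 //.
  by apply/setP => -[].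
have -> : s = 1%g by apply/permP => -[].
by rewrite eqxx; apply/Av_132_213P => -[].
Qed.

Lemma B_132_213_S (n : nat) : B_132_213 n.+1 = bdes_sum 'X false n.
Proof. by apply: eq_bigr => s avs; rewrite bdes_ascents. Qed.

Theorem theorem3p8 :
  let x : {poly {poly int}} := 'X in
  let t : {poly {poly int}} := ('X : {poly int})%:P in
  B_132_213 =1
    fps_div
      (fps_of_poly (1 - x + (1 - t) * x ^+ 2 - (1 - t) ^+ 2 * x ^+ 3))
      (fps_of_poly (1 - 2%:R * x + (1 - t) * x ^+ 2 + t * (1 - t) * x ^+ 3)).
Proof.
move=> x t; pose c : {poly int} := 'X.
have -> : 1 - x + (1 - t) * x ^+ 2 - (1 - t) ^+ 2 * x ^+ 3
        = Poly [:: 1; -1; 1 - c; - (1 - c) ^+ 2].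
  by rewrite /= !cons_poly_def /x /t -/c; ring.
have -> : 1 - 2%:R * x + (1 - t) * x ^+ 2 + t * (1 - t) * x ^+ 3
        = Poly [:: 1; - 2%:R; 1 - c; c * (1 - c)].
  by rewrite /= !cons_poly_def /x /t -/c; ring.
apply: fps_div_unique => [|n]; first by rewrite /fps_of_poly coef_Poly unitr1.
have rec := bdes_sum_rec c.
have Q0 := bdes_sum_descent0 c; have P0 := bdes_sum0 c.
rewrite /fps_mul /fps_of_poly coef_Poly.
(* Since [bdes_sum] at n is the coefficient n + 1 of the series, the recurrence covers coefficients
   from 4 on; those up to 3 give the numerator. *)
case: n => [|[|[|[|n]]]]; rewrite !big_ord_recl ?big_ord0 !coef_Poly /=
  ?subn0 ?B_132_213_0 ?B_132_213_S -/c.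
- by rewrite mulr1 addr0.
- by rewrite P0; ring.
- by rewrite bdes_sum_falseS !P0 Q0; ring.
- rewrite 2!bdes_sum_falseS bdes_sum_trueS bdes_sum_descentS !P0 Q0; ring.
- rewrite big1 => [|i _]; last by rewrite !coef_cons /= coefC mul0r.
  by rewrite nth_nil -[RHS](rec n); ring.
Qed.
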